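(* Let $X:\Omega\to\mathbb{C}^{N\times m}$ be a solution of the Grassmannian sigma model equations and let $Z:\Omega\to\mathfrak{su}(N)$ be the associated surface. Then the components of the metric induced on the surface by the scalar product on $\mathfrak{su}(N)$ are $$(\partial_L Z,\partial_L Z)=J_L,\qquad (\partial_R Z,\partial_R Z)=J_R,\qquad (\partial_L Z,\partial_R Z)=G_{LR},$$ where $$J_D=\operatorname{tr}(\partial_D X\,\partial_D X^\dagger P)\ (D=L,R),\qquad G_{LR}=-\operatorname{tr}\left(\frac{\partial_L X\,\partial_R X^\dagger+\partial_R X\,\partial_L X^\dagger}{2}\,P\right).$$ Consequently the first fundamental form of the surface is $$I=J_L(d\xi_L)^2+2G_{LR}\,d\xi_L\,d\xi_R+J_R(d\xi_R)^2=\sum_{B,D\in\{L,R\}}(2\delta_{B,D}-1)\operatorname{tr}(\partial_B X\,\partial_D X^\dagger P)\,d\xi_B\,d\xi_D ,$$ where $\delta_{B,D}=1$ if $B=D$ and $0$ otherwise.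
   Context: Let $m,n\ge 1$ and $N=m+n$. Let $\Omega\subset\mathbb{R}^2$ be open, connected and simply connected, with light-cone coordinates $\xi_L=\xi^0+\xi^1$, $\xi_R=\xi^0-\xi^1$, and write $\partial_L=\partial/\partial\xi_L$, $\partial_R=\partial/\partial\xi_R$. A dagger denotes the conjugate transpose, and $\partial_D X^\dagger=\partial_D(X^\dagger)=(\partial_D X)^\dagger$. A smooth map $X:\Omega\to\mathbb{C}^{N\times m}$ with $X^\dagger X=\mathbf{1}_{m\times m}$ represents a map into the Grassmannian $G(m,n)=SU(N)/S(U(m)\times U(n))$. Put $P=\mathbf{1}-XX^\dagger$, an orthogonal projector. $X$ is called a solution of the Grassmannian sigma model (Euler--Lagrange) equations if $[\partial_L\partial_R P,P]=0$ on $\Omega$, equivalently $\partial_L[\partial_R P,P]+\partial_R[\partial_L P,P]=0$. The algebra $\mathfrak{su}(N)$ of traceless anti-Hermitian $N\times N$ matrices is equipped with the scalar product $(A,B)=-\frac12\operatorname{tr}(AB)$ and so identified with Euclidean space $\mathbb{R}^{N^2-1}$. For a solution $X$, the associated surface is the smooth map $Z:\Omega\to\mathfrak{su}(N)$, unique up to an additive constant, with $$\partial_L Z=[\partial_L P,P],\qquad \partial_R Z=-[\partial_R P,P];$$ it exists because these equations define a closed $1$-form on the simply connected set $\Omega$. *)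

(* Defs.v *)
From HB Require Import structures.
From mathcomp Require Import all_boot all_order all_algebra.
From mathcomp Require Import complex.
From mathcomp Require Import all_classical all_reals all_analysis.

Set Implicit Arguments.
Unset Strict Implicit.
Unset Printing Implicit Defensive.

Import Order.TTheory GRing.Theory Num.Theory.
Import numFieldNormedType.Exports.

Local Open Scope classical_set_scope.
Local Open Scope ring_scope.
Local Open Scope sesquilinear_scope.
Local Open Scope complex_scope.

Inductive lightcone := LC | RC.

Definition lightcone_bool (D : lightcone) : bool := if D is LC then true else false.
Definition bool_lightcone (b : bool) : lightcone := if b then LC else RC.
Lemma lightcone_boolK : cancel lightcone_bool bool_lightcone.
Proof. by case. Qed.
HB.instance Definition _ := Finite.copy lightcone (can_type lightcone_boolK).

Section Plane.
Variable R : realType.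

(* Every loop in A is null-homotopic in A, with base point fixed. Connectedness
   is not part of this definition. *)
Definition simply_connected (A : set (R * R)) :=
  forall g : R -> R * R,
    {within `[0, 1], continuous g} -> g @` `[0, 1] `<=` A -> g 0 = g 1 ->
  exists H : R * R -> R * R,
    [/\ {within `[0, 1] `*` `[0, 1], continuous H},
        H @` (`[0, 1] `*` `[0, 1]) `<=` A,
        forall t : R, t \in `[0, 1] -> H (0, t) = g t /\ H (1, t) = g 0
      & forall s : R, s \in `[0, 1] -> H (s, 0) = g 0 /\ H (s, 1) = g 0].

(* A point or tangent vector of the plane is the pair of its coordinates
   xi^0, xi^1. Since xi^0 = (xi_L + xi_R) / 2 and xi^1 = (xi_L - xi_R) / 2, the
   coordinate vector fields of xi_L and xi_R are (1/2, 1/2) and (1/2, -1/2). *)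
Definition lc_vec (D : lightcone) : R * R :=
  if D is LC then (2^-1, 2^-1) else (2^-1, - 2^-1).

Definition dxi (D : lightcone) (v : R * R) : R :=
  if D is LC then v.1 + v.2 else v.1 - v.2.

Definition sym_prod (a b : R * R -> R) (u v : R * R) : R :=
  (a u * b v + b u * a v) / 2.

Fixpoint iter_derive (w : seq (R * R)) (f : R * R -> R) : R * R -> R :=
  if w is v :: w' then 'D_v (iter_derive w' f) else f.

(* For open A this is the class of C^oo functions on A: values off A are
   irrelevant. *)
Definition smooth_on (A : set (R * R)) (f : R * R -> R) :=
  forall (w : seq (R * R)) (p : R * R), A p -> differentiable (iter_derive w f) p.

Definition mx_smooth_on (A : set (R * R)) r c (F : R * R -> 'M[R[i]]_(r, c)) :=
  forall i j, smooth_on A (fun q => complex.Re (F q i j)) /\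
              smooth_on A (fun q => complex.Im (F q i j)).

(* R[i] is normed over itself, not over R, so complex matrices are
   differentiated through the real and imaginary parts of their entries. *)
Definition mx_derive (v : R * R) r c (F : R * R -> 'M[R[i]]_(r, c)) (p : R * R) :
    'M[R[i]]_(r, c) :=
  \matrix_(i, j) ('D_v (fun q => complex.Re (F q i j)) p
               +i* 'D_v (fun q => complex.Im (F q i j)) p).

Definition lc_derive (D : lightcone) r c (F : R * R -> 'M[R[i]]_(r, c)) :=
  mx_derive (lc_vec D) F.

End Plane.

Notation "'\partial_' D F" := (lc_derive D F)
  (at level 10, D at level 2, F at next level, format "'\partial_' D  F").

Section SigmaModel.
Variable R : realType.
Local Notation C := R[i].

Definition commutator N (A B : 'M[C]_N) : 'M[C]_N := A *m B - B *m A.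

Definition in_su N (A : 'M[C]_N) := A ^t* = - A /\ \tr A = 0.

(* Real-valued on su(N). *)
Definition su_scal N (A B : 'M[C]_N) : C := - 2^-1 * \tr (A *m B).

Section Solution.
Variables m n : nat.
Local Notation N := (m + n)%N.

Definition projector (X : R * R -> 'M[C]_(N, m)) (q : R * R) : 'M[C]_N :=
  1%:M - X q *m (X q) ^t*.

Record sigma_solution (Omega : set (R * R)) (X : R * R -> 'M[C]_(N, m)) : Prop :=
  SigmaSolution {
    sol_smooth : mx_smooth_on Omega X;
    sol_unitary : forall p, Omega p -> (X p) ^t* *m X p = 1%:M;
    sol_EL : forall p, Omega p ->
      commutator (\partial_LC (\partial_RC (projector X)) p) (projector X p) = 0
  }.

Record associated_surface (Omega : set (R * R)) (X : R * R -> 'M[C]_(N, m))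
    (Z : R * R -> 'M[C]_N) : Prop := AssociatedSurface {
  surf_smooth : mx_smooth_on Omega Z;
  surf_su : forall p, Omega p -> in_su (Z p);
  surf_L : forall p, Omega p ->
    \partial_LC Z p = commutator (\partial_LC (projector X) p) (projector X p);
  surf_R : forall p, Omega p ->
    \partial_RC Z p = - commutator (\partial_RC (projector X) p) (projector X p)
}.

Definition J (X : R * R -> 'M[C]_(N, m)) (D : lightcone) (p : R * R) : C :=
  \tr (\partial_D X p *m (\partial_D X p) ^t* *m projector X p).

Definition G_LR (X : R * R -> 'M[C]_(N, m)) (p : R * R) : C :=
  - \tr (2^-1 *: (\partial_LC X p *m (\partial_RC X p) ^t* + \partial_RC X p *m (\partial_LC X p) ^t*)
         *m projector X p).

End Solution.

(* The pullback of the scalar product by the differential of Z at p, as a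
   symmetric bilinear form on tangent vectors. *)
Definition first_form N (Z : R * R -> 'M[C]_N) (p u v : R * R) : C :=
  su_scal (mx_derive u Z p) (mx_derive v Z p).

End SigmaModel.

(* Main.v *)
Require Import Defs.
From HB Require Import structures.
From mathcomp Require Import all_boot all_order all_algebra.
From mathcomp Require Import complex ring.
From mathcomp Require Import all_classical all_reals all_analysis.

Import Order.TTheory GRing.Theory Num.Theory.
Import numFieldNormedType.Exports.

Local Open Scope classical_set_scope.
Local Open Scope ring_scope.
Local Open Scope sesquilinear_scope.
Local Open Scope complex_scope.

(** At a point [p] put [x = X p]. The product rule gives [dP = - (dX x^* + x dX^* )],
    and [P x = 0], [x^* P = 0] turn the current [[dP, P]] into [h - h^*], where
    [h = P dX x^*]. Products of two such [h] vanish since [x^* P = 0], so only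
    the mixed traces [tr (h_B h_D^* ) = tr (dX_B dX_D^* P)] survive in the scalar
    product. The formula for [I] then follows by expanding a tangent vector along
    the coordinate fields of [xi_L], [xi_R]. *)

(** * Derivative rules for complex-valued functions on the real plane *)

Section ComplexDerivative.
Context {R : realType}.
Implicit Types (v p : R * R) (f g : R * R -> R[i]).

(** Existence and value of the derivative are carried together, so the sum, product and conjugation
    rules compose without separate derivability conditions; [is_mx_derive_val] finally turns them
    into an equation for [mx_derive]. *)
Definition is_cderive p v f (df : R[i]) :=
  is_derive p v (fun q => complex.Re (f q)) (complex.Re df) /\
  is_derive p v (fun q => complex.Im (f q)) (complex.Im df).

Lemma is_cderive_cst p v (c : R[i]) : is_cderive p v (fun=> c) 0.
Proof. by split; exact: is_derive_cst. Qed.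

Lemma is_cderiveB {p v f g df dg} :
  is_cderive p v f df -> is_cderive p v g dg ->
  is_cderive p v (fun q => f q - g q) (df - dg).
Proof.
move=> [fr fi] [gr gi]; split.
- have -> : (fun q => complex.Re (f q - g q)) =
    (fun q => complex.Re (f q)) - (fun q => complex.Re (g q)).
    by apply/funext => q /=; rewrite raddfB.
  by rewrite raddfB; exact: is_deriveB.
- have -> : (fun q => complex.Im (f q - g q)) =
    (fun q => complex.Im (f q)) - (fun q => complex.Im (g q)).
    by apply/funext => q /=; rewrite raddfB.
  by rewrite raddfB; exact: is_deriveB.
Qed.

Lemma is_cderive_sum {k p v} {h : 'I_k -> R * R -> R[i]} {dh : 'I_k -> R[i]} :
  (forall i, is_cderive p v (h i) (dh i)) ->
  is_cderive p v (fun q => \sum_i h i q) (\sum_i dh i).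
Proof.
move=> hD; split.
- have -> : (fun q => complex.Re (\sum_i h i q)) =
    \sum_i (fun q => complex.Re (h i q)).
    by apply/funext => q; rewrite raddf_sum fct_sumE.
  by rewrite raddf_sum; apply: is_derive_sum => i; case: (hD i).
- have -> : (fun q => complex.Im (\sum_i h i q)) =
    \sum_i (fun q => complex.Im (h i q)).
    by apply/funext => q; rewrite raddf_sum fct_sumE.
  by rewrite raddf_sum; apply: is_derive_sum => i; case: (hD i).
Qed.

Lemma is_cderiveM {p v f g df dg} :
  is_cderive p v f df -> is_cderive p v g dg ->
  is_cderive p v (fun q => f q * g q) (df * g p + f p * dg).
Proof.
move=> [fr fi] [gr gi]; split.
- have -> : (fun q => complex.Re (f q * g q)) =
    (fun q => complex.Re (f q)) * (fun q => complex.Re (g q)) -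
    (fun q => complex.Im (f q)) * (fun q => complex.Im (g q)).
    by apply/funext => q /=; rewrite !fctE; case: (f q) (g q) => a b [c d].
  apply: (is_derive_eq (is_deriveB (is_deriveM fr gr) (is_deriveM fi gi))).
  by case: (f p) (g p) df dg fr fi gr gi => a b [c d] [a' b'] [c' d'] * /=;
     rewrite /GRing.scale /=; ring.
- have -> : (fun q => complex.Im (f q * g q)) =
    (fun q => complex.Re (f q)) * (fun q => complex.Im (g q)) +
    (fun q => complex.Im (f q)) * (fun q => complex.Re (g q)).
    apply/funext => q /=; rewrite !fctE; case: (f q) (g q) => a b [c d] //=.
  apply: (is_derive_eq (is_deriveD (is_deriveM fr gi) (is_deriveM fi gr))).
  by case: (f p) (g p) df dg fr fi gr gi => a b [c d] [a' b'] [c' d'] * /=;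
     rewrite /GRing.scale /=; ring.
Qed.

Lemma is_cderive_conj {p v f df} :
  is_cderive p v f df -> is_cderive p v (fun q => Num.conj (f q)) (Num.conj df).
Proof.
have ReJ (z : R[i]) : complex.Re (Num.conj z) = complex.Re z by case: z.
have ImJ (z : R[i]) : complex.Im (Num.conj z) = - complex.Im z by case: z.
move=> [fr fi]; split.
  by rewrite ReJ; under [X in is_derive _ _ X]funext do rewrite ReJ.
by rewrite ImJ; under [X in is_derive _ _ X]funext do rewrite ImJ; exact: is_deriveN.
Qed.

End ComplexDerivative.

(** * Derivatives of complex matrices and their light-cone expansion *)

Section MatrixDerivative.
Context {R : realType}.
Implicit Types (v p : R * R).

Definition is_mx_derive p v r c (F : R * R -> 'M[R[i]]_(r, c)) (dF : 'M[R[i]]_(r, c)) :=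
  forall i j, is_cderive p v (fun q => F q i j) (dF i j).
Arguments is_mx_derive p v {r c}.

Lemma is_mx_derive_val {p v r c} {F : R * R -> 'M[R[i]]_(r, c)} {dF} :
  is_mx_derive p v F dF -> mx_derive v F p = dF.
Proof.
move=> FD; apply/matrixP => i j; rewrite mxE; case: (FD i j) => Fr Fi.
by rewrite !derive_val; case: (dF i j).
Qed.

Lemma mx_smooth_is_derive {A p v r c} {F : R * R -> 'M[R[i]]_(r, c)} :
  mx_smooth_on A F -> A p -> is_mx_derive p v F (mx_derive v F p).
Proof.
(* The empty word [[::]] in [smooth_on] gives differentiability of the entry itself. *)
move=> Fs Ap i j; rewrite mxE; case: (Fs i j) => /(_ [::] p Ap) Fr /(_ [::] p Ap) Fi.
by split; apply: DeriveDef => //; exact: diff_derivable.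
Qed.

Lemma is_mx_derive_cst p v r c (K : 'M[R[i]]_(r, c)) : is_mx_derive p v (fun=> K) 0.
Proof. by move=> i j; rewrite mxE; exact: is_cderive_cst. Qed.

Lemma is_mx_deriveB {p v r c} {F G : R * R -> 'M[R[i]]_(r, c)} {dF dG} :
  is_mx_derive p v F dF -> is_mx_derive p v G dG ->
  is_mx_derive p v (fun q => F q - G q) (dF - dG).
Proof.
move=> FD GD i j; rewrite !mxE.
by under [X in is_cderive _ _ X]funext do rewrite !mxE; exact: is_cderiveB.
Qed.

Lemma is_mx_deriveM {p v r c d} {F : R * R -> 'M[R[i]]_(r, c)}
    {G : R * R -> 'M[R[i]]_(c, d)} {dF dG} :
  is_mx_derive p v F dF -> is_mx_derive p v G dG ->
  is_mx_derive p v (fun q => F q *m G q) (dF *m G p + F p *m dG).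
Proof.
move=> FD GD i j; rewrite !mxE -big_split /=.
under [X in is_cderive _ _ X]funext do rewrite mxE.
by apply: is_cderive_sum => k; exact: is_cderiveM.
Qed.

Lemma is_mx_derive_trmxC {p v r c} {F : R * R -> 'M[R[i]]_(r, c)} {dF} :
  is_mx_derive p v F dF -> is_mx_derive p v (fun q => F q ^t*) (dF ^t*).
Proof.
move=> FD i j; rewrite !mxE.
by under [X in is_cderive _ _ X]funext do rewrite !mxE; exact: is_cderive_conj.
Qed.

(** Differentiability makes ['D_v f p] linear in [v], and [dxi LC], [dxi RC] are the coordinates of
    [v] in the basis [lc_vec]. *)
Lemma derive_lightcone {f : R * R -> R} {p} v : differentiable f p ->
  'D_v f p = dxi LC v * 'D_(lc_vec R LC) f p + dxi RC v * 'D_(lc_vec R RC) f p.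
Proof.
move=> fD; have vE : v = dxi LC v *: lc_vec R LC + dxi RC v *: lc_vec R RC.
  by case: v => a b; congr (_, _); rewrite /= /GRing.scale /=; field.
by rewrite !(deriveE _ fD) {1}vE linearD !linearZ.
Qed.

Lemma mx_derive_lightcone {A p r c} {F : R * R -> 'M[R[i]]_(r, c)} v :
  mx_smooth_on A F -> A p ->
  mx_derive v F p = (dxi LC v)%:C *: \partial_LC F p + (dxi RC v)%:C *: \partial_RC F p.
Proof.
move=> Fs Ap; apply/matrixP => i j.
rewrite /lc_derive /mx_derive [LHS]mxE [RHS]mxE [X in _ = X + _]mxE [X in _ = _ + X]mxE.
rewrite [X in _ = _ * X + _]mxE [X in _ = _ + _ * X]mxE.
case: (Fs i j) => /(_ [::] p Ap) Fr /(_ [::] p Ap) Fi.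
rewrite (derive_lightcone v Fr) (derive_lightcone v Fi).
(* The coordinates of [v] are real, so they scale real and imaginary parts separately. *)
have scaleC (x y a b c' d : R) :
    (x * a + y * b) +i* (x * c' + y * d) = x%:C * (a +i* c') + y%:C * (b +i* d).
  by apply/eqP; rewrite eq_complex /= !mul0r !subr0 !addr0 !eqxx.
exact: scaleC.
Qed.

End MatrixDerivative.

(** * The current of the projector and its scalar products *)

Section ProjectorCurrent.
Context {R : realType}.

Lemma trmxC_mul {r c d} (A : 'M[R[i]]_(r, c)) (B : 'M[R[i]]_(c, d)) :
  (A *m B) ^t* = B ^t* *m A ^t*.
Proof. by rewrite trmx_mul map_mxM. Qed.

Lemma trmxCB {r c} (A B : 'M[R[i]]_(r, c)) : (A - B) ^t* = A ^t* - B ^t*.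
Proof. by rewrite linearB /= map_mxB. Qed.

Lemma trmxC1 k : (1%:M : 'M[R[i]]_k) ^t* = 1%:M.
Proof. by rewrite trmx1 map_mx1. Qed.

(** Of the four products, [F *m G] and [F ^t* *m G ^t*], the adjoint of [G *m F], vanish. The two
    mixed ones carry a minus sign that cancels the one in [su_scal]. *)
Lemma su_scal_skew {k} {F G : 'M[R[i]]_k} : F *m G = 0 -> G *m F = 0 ->
  su_scal (F - F ^t*) (G - G ^t*) = 2^-1 * (\tr (F *m G ^t*) + \tr (G *m F ^t*)).
Proof.
move=> FG GF; rewrite /su_scal mulmxBl !mulmxBr FG -trmxC_mul GF trmx0 map_mx0.
rewrite sub0r subr0 raddfB raddfN /= [\tr (F ^t* *m G)]mxtrace_mulC.
by rewrite -opprD mulrNN.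
Qed.

(** For [P = 1 - x x^*], the factor [P *m A] is the component of the variation [A] orthogonal to the
    column space of the frame [x]; multiplying by [x ^t*] makes it an operator from that space to
    its complement. *)
Definition horizontal {N m} (P : 'M[R[i]]_N) (x A : 'M[R[i]]_(N, m)) : 'M[R[i]]_N :=
  P *m A *m x ^t*.

Lemma complement_projector {N m} {P : 'M[R[i]]_N} {x : 'M[R[i]]_(N, m)} :
  x ^t* *m x = 1%:M -> P = 1%:M - x *m x ^t* ->
  [/\ P *m x = 0, x ^t* *m P = 0, P *m P = P & P ^t* = P].
Proof.
move=> xx PE.
have Px : P *m x = 0 by rewrite PE mulmxBl mul1mx -mulmxA xx mulmx1 subrr.
split=> //.
- by rewrite PE mulmxBr mulmx1 mulmxA xx mul1mx subrr.
- by rewrite {2}PE mulmxBr mulmx1 mulmxA Px mul0mx subr0.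
- by rewrite PE trmxCB trmxC1 trmxC_mul trmxCK.
Qed.

Lemma su_scal_horizontal {N m} {P : 'M[R[i]]_N} {x : 'M[R[i]]_(N, m)} :
  x ^t* *m x = 1%:M -> P = 1%:M - x *m x ^t* ->
  forall A B, su_scal (horizontal P x A - (horizontal P x A) ^t*)
                      (horizontal P x B - (horizontal P x B) ^t*) =
  2^-1 * (\tr (A *m B ^t* *m P) + \tr (B *m A ^t* *m P)).
Proof.
move=> xx PE A B.
have [Px xP PP PC] := complement_projector xx PE.
have hh E F : horizontal P x E *m horizontal P x F = 0.
  by rewrite /horizontal -!mulmxA (mulmxA (x ^t*)) xP mul0mx !mulmx0.
(* The inner [x ^t* *m x] collapses to the identity; cyclicity of the trace brings the two outer
   factors [P] together, and [P *m P = P]. *)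
have hhC E F : \tr (horizontal P x E *m (horizontal P x F) ^t*) = \tr (E *m F ^t* *m P).
  rewrite /horizontal !trmxC_mul trmxCK PC.
  by rewrite -!mulmxA (mulmxA (x ^t*)) xx mul1mx mxtrace_mulC -!mulmxA PP.
move: (horizontal P x) hh hhC => h hh hhC.
by rewrite (su_scal_skew (hh A B) (hh B A)) !hhC.
Qed.

Lemma commutator_derive_projector {m n} {A : set (R * R)}
    {X : R * R -> 'M[R[i]]_(m + n, m)} D {p} :
  mx_smooth_on A X -> A p -> (X p) ^t* *m X p = 1%:M ->
  commutator (\partial_D (projector X) p) (projector X p) =
  horizontal (projector X p) (X p) (\partial_D X p) -
  (horizontal (projector X p) (X p) (\partial_D X p)) ^t*.
Proof.
move=> Xs Ap xx.
have XD := mx_smooth_is_derive (v := lc_vec R D) Xs Ap.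
have -> : \partial_D (projector X) p = _ :=
  is_mx_derive_val (is_mx_deriveB (is_mx_derive_cst p (lc_vec R D) _ _ 1%:M)
    (is_mx_deriveM XD (is_mx_derive_trmxC XD))).
rewrite -[mx_derive _ X p]/(\partial_D X p).
have : projector X p = 1%:M - X p *m X p ^t* by [].
(* From here on only matrix algebra at the single point [p] remains. *)
move: (projector X p) (\partial_D X p) (X p) xx => P dx x xx PE.
have [Px xP _ PC] := complement_projector xx PE.
rewrite /commutator /horizontal !trmxC_mul trmxCK PC.
rewrite sub0r mulNmx mulmxN opprK mulmxDl mulmxDr -!mulmxA xP.
by rewrite !mulmxA Px mul0mx mulmx0 add0r addr0 addrC.
Qed.

End ProjectorCurrent.

(** * Bilinearity of the scalar product and expansion of the first fundamental form *)

Section ScalarProduct.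
Context {R : realType} {k : nat}.
Implicit Types A B C : 'M[R[i]]_k.

Lemma su_scalC A B : su_scal A B = su_scal B A.
Proof. by rewrite /su_scal mxtrace_mulC. Qed.

Lemma su_scalDl A B C : su_scal (A + B) C = su_scal A C + su_scal B C.
Proof. by rewrite /su_scal mulmxDl mxtraceD mulrDr. Qed.

Lemma su_scalZl a A B : su_scal (a *: A) B = a * su_scal A B.
Proof. by rewrite /su_scal -scalemxAl mxtraceZ mulrCA. Qed.

Lemma su_scalDr A B C : su_scal A (B + C) = su_scal A B + su_scal A C.
Proof. by rewrite su_scalC su_scalDl !(su_scalC _ A). Qed.

Lemma su_scalZr a A B : su_scal A (a *: B) = a * su_scal A B.
Proof. by rewrite su_scalC su_scalZl su_scalC. Qed.

Lemma su_scal_lin_comb {A B x y z} a b c d :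
  su_scal A A = x -> su_scal B B = y -> su_scal A B = z ->
  su_scal (a *: A + b *: B) (c *: A + d *: B) = a * c * x + (a * d + b * c) * z + b * d * y.
Proof.
move=> AA BB AB; rewrite !(su_scalDl, su_scalDr, su_scalZl, su_scalZr) (su_scalC B A).
by rewrite AA BB AB; ring.
Qed.

Lemma su_scalNr A B : su_scal A (- B) = - su_scal A B.
Proof. by rewrite -scaleN1r su_scalZr mulN1r. Qed.

Lemma su_scalNN A B : su_scal (- A) (- B) = su_scal A B.
Proof. by rewrite su_scalNr su_scalC su_scalNr opprK su_scalC. Qed.

Lemma sym_prod_complex (a b : R * R -> R) u v :
  (sym_prod a b u v)%:C = ((a u)%:C * (b v)%:C + (b u)%:C * (a v)%:C) / 2 :> R[i].
Proof. by rewrite /sym_prod rmorphM fmorphV rmorph_nat rmorphD !rmorphM. Qed.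

(** Both tangent vectors are expanded in the coordinate fields. The cross terms share the value [z]
    by symmetry, and the factor 2 undoes the division by 2 in [sym_prod]. *)
Lemma first_form_lightcone {S : set (R * R)} {Z : R * R -> 'M[R[i]]_k} {p x y z} u v :
  mx_smooth_on S Z -> S p ->
  su_scal (\partial_LC Z p) (\partial_LC Z p) = x ->
  su_scal (\partial_RC Z p) (\partial_RC Z p) = y ->
  su_scal (\partial_LC Z p) (\partial_RC Z p) = z ->
  first_form Z p u v =
    x * (sym_prod (dxi LC) (dxi LC) u v)%:C
    + 2 * z * (sym_prod (dxi LC) (dxi RC) u v)%:C
    + y * (sym_prod (dxi RC) (dxi RC) u v)%:C.
Proof.
move=> Zs Sp LL RR LR; rewrite /first_form !(mx_derive_lightcone _ Zs Sp).
rewrite (su_scal_lin_comb _ _ _ _ LL RR LR) !sym_prod_complex.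
by field.
Qed.

Lemma sum_lightcone (F : lightcone -> R[i]) : \sum_D F D = F LC + F RC.
Proof. by rewrite (bigD1 LC) //= (bigD1 RC) //= big1 ?addr0 // => -[]. Qed.

(** The weight is 1 on the diagonal and -1 off it. The two off-diagonal terms have the same
    symmetric product, so only the sum of their coefficients matters; it is written as twice minus
    their mean to match [G_LR]. *)
Lemma sum_sym_prod (t : lightcone -> lightcone -> R[i]) u v :
  \sum_B \sum_D (2 * (B == D)%:R - 1) * t B D * (sym_prod (dxi B) (dxi D) u v)%:C =
    t LC LC * (sym_prod (dxi LC) (dxi LC) u v)%:C
    + 2 * - (2^-1 * (t LC RC + t RC LC)) * (sym_prod (dxi LC) (dxi RC) u v)%:C
    + t RC RC * (sym_prod (dxi RC) (dxi RC) u v)%:C.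
Proof.
rewrite !sum_lightcone !eqxx -[LC == RC]/false -[RC == LC]/false /= mulr1n mulr0n.
by rewrite !sym_prod_complex; field.
Qed.

End ScalarProduct.

(** * Metric components and first fundamental form of the surface *)

Theorem mainTheorem1 (R : realType) (m n : nat) (m_ge1 : (1 <= m)%N) (n_ge1 : (1 <= n)%N)
    (Omega : set (R * R)) (Omega_open : open Omega)
    (Omega_connected : connected Omega) (Omega_sc : simply_connected Omega)
    (X : R * R -> 'M[R[i]]_(m + n, m)) (X_sol : sigma_solution Omega X)
    (Z : R * R -> 'M[R[i]]_(m + n)) (Z_surf : associated_surface Omega X Z)
    (p : R * R) (Omega_p : Omega p) :
  [/\ su_scal (\partial_LC Z p) (\partial_LC Z p) = J X LC p,
      su_scal (\partial_RC Z p) (\partial_RC Z p) = J X RC p,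
      su_scal (\partial_LC Z p) (\partial_RC Z p) = G_LR X p
    & forall u v : R * R,
        first_form Z p u v =
          J X LC p * (sym_prod (dxi LC) (dxi LC) u v)%:C
          + 2 * G_LR X p * (sym_prod (dxi LC) (dxi RC) u v)%:C
          + J X RC p * (sym_prod (dxi RC) (dxi RC) u v)%:C
        /\
        first_form Z p u v =
          \sum_(B : lightcone) \sum_(D : lightcone)
            (2 * (B == D)%:R - 1)
            * \tr (\partial_B X p *m (\partial_D X p) ^t* *m projector X p)
            * (sym_prod (dxi B) (dxi D) u v)%:C ].
Proof.
case: X_sol Z_surf => Xs XX _ [Zs _ ZL ZR].
have comm D := commutator_derive_projector D Xs Omega_p (XX p Omega_p).
have scal := su_scal_horizontal (XX p Omega_p) (erefl (projector X p)).
(* For equal directions the two mixed traces coincide, and their mean is [J]. *)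
have half (z : R[i]) : 2^-1 * (z + z) = z by field.
have trG : G_LR X p = - (2^-1 *
    (\tr (\partial_LC X p *m (\partial_RC X p) ^t* *m projector X p)
   + \tr (\partial_RC X p *m (\partial_LC X p) ^t* *m projector X p))).
  by rewrite /G_LR -scalemxAl mxtraceZ mulmxDl mxtraceD.
have LL : su_scal (\partial_LC Z p) (\partial_LC Z p) = J X LC p.
  by rewrite (ZL p Omega_p) comm scal half.
have RR : su_scal (\partial_RC Z p) (\partial_RC Z p) = J X RC p.
  (* The sign of the [RC] current occurs twice and cancels. *)
  rewrite (ZR p Omega_p) comm su_scalNN scal; exact: half.
have LR : su_scal (\partial_LC Z p) (\partial_RC Z p) = G_LR X p.
  (* Here that sign occurs once; it is the source of the minus in [G_LR]. *)
  rewrite trG (ZL p Omega_p) comm (ZR p Omega_p) comm su_scalNr scal.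
  exact: erefl.
have first u v := first_form_lightcone u v Zs Omega_p LL RR LR.
split; [exact: LL | exact: RR | exact: LR | move=> u v; split; first exact: first].
rewrite first trG; apply: esym.
exact: (sum_sym_prod (fun B D =>
  \tr (\partial_B X p *m (\partial_D X p) ^t* *m projector X p))).
Qed.
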